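(* Let $\mathcal{K}$ be the class of compact convex bodies in $\mathbb{R}^n$ with $0$ in their interior, and let $B_2^n$ be the closed Euclidean unit ball. There exist maps $K\mapsto K^{\lambda}$ from $\mathcal{K}$ to $\mathcal{K}$, one for each $0\le\lambda<\infty$, with the following properties: (1) $K^{1}=K$ and $K^{0}=B_2^n$ for all $K\in\mathcal{K}$. (2) If $K_1\subseteq K_2$ then $K_1^{\lambda}\subseteq K_2^{\lambda}$. (3) $(tK)^{\lambda}=t^{\lambda}K^{\lambda}$ for $t>0$. (4) $K^{\lambda}$ is continuous with respect to both $K$ and $\lambda$: if $K_i\to K$ and $\lambda_i\to\lambda$ then $K_i^{\lambda_i}\to K^{\lambda}$. (5) $(K^{\lambda})^{\mu}=K^{\lambda\mu}$ whenever $0\le\lambda,\mu\le1$, and whenever $1\le\lambda,\mu<\infty$. (6) If $aB_2^n\subseteq K\subseteq\sqrt{2}\,a\,B_2^n$ for some $a>0$, then $(K^{\lambda})^{1/\lambda}=K$ for all $0<\lambda\le1$.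
   Context: Convergence $K_i\to K$ of compact convex bodies with $0$ in their interior means convergence in the Hausdorff metric; equivalently, there is a sequence $\epsilon_i\to0$ with $(1-\epsilon_i)K\subseteq K_i\subseteq(1+\epsilon_i)K$ for all sufficiently large $i$. *)

(* Defs.v *)
From mathcomp Require Import all_boot all_order all_algebra.
From mathcomp Require Import all_classical all_reals all_analysis.
Set Implicit Arguments.
Unset Strict Implicit.
Unset Printing Implicit Defensive.
Import Order.TTheory GRing.Theory Num.Theory.
Import numFieldNormedType.Exports.
Local Open Scope classical_set_scope.
Local Open Scope ring_scope.

(* The library norm `|x| on 'rV[R]_n is the sup norm; it induces the usual
   topology (used below for compactness and interiors), but the unit ball and
   the Hausdorff metric are taken with respect to the Euclidean norm. *)
Definition enorm (R : realType) (n : nat) (x : 'rV[R]_n) : R :=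
  Num.sqrt (\sum_(i < n) x ord0 i ^+ 2).

Definition B2 (R : realType) (n : nat) : set 'rV[R]_n :=
  [set x | enorm x <= 1].

Definition dilate (R : realType) (n : nat) (t : R) (K : set 'rV[R]_n) :
    set 'rV[R]_n :=
  [set t *: x | x in K].

Definition convex_bodies (R : realType) (n : nat) : set (set 'rV[R]_n) :=
  [set K | [/\ compact K,
               convex_set (K : set (convex_lmodType 'rV[R]_n)) &
               interior K 0]].

(* The infimum is that of a nonempty set bounded below by 0, hence not the
   default value of inf, whenever K and L are nonempty and bounded. *)
Definition hausdorff_dist (R : realType) (n : nat) (K L : set 'rV[R]_n) : R :=
  inf [set e : R | [/\ 0 <= e,
    (forall x, K x -> exists2 y, L y & enorm (x - y) <= e) &
    (forall y, L y -> exists2 x, K x & enorm (x - y) <= e)]].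

Definition hausdorff_cvg (R : realType) (n : nat)
    (K_ : nat -> set 'rV[R]_n) (K : set 'rV[R]_n) : Prop :=
  hausdorff_dist (K_ i) K @[i --> \oo] --> (0 : R).

(* Main.v *)
(* Let P_s be the radial map x |-> |x|^(s-1) x. These maps form a flow, but
   P_s K need not be convex. So let K^s be the value at s of the least family T of
   intersections of half-spaces, starting at T_1 containing K, such that
   P_(t/s) T_s is contained in T_t whenever t is further away from 1 than s on
   the same side. Minimality yields monotonicity, homogeneity and the semigroup
   laws on [0, 1] and on [1, +oo[. If B/M <= K <= M B then K^s and K^t agree up
   to a dilation by M^|s - t|, which gives continuity.

   If a B <= K <= sqrt 2 a B, all directions met are within pi/4 of the normals
   of the supporting half-spaces, and since log (1 + x^2) is convex on [0, 1]
   (here x is the tangent of the angle), P_s K is convex for s <= 1. The flow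
   then coincides with P_s, which is invertible. *)
Require Import Defs.
From mathcomp Require Import all_boot all_order all_algebra.
From mathcomp Require Import all_classical all_reals all_analysis.
From mathcomp Require Import ring lra.
Set Implicit Arguments.
Unset Strict Implicit.
Unset Printing Implicit Defensive.
Import Order.TTheory GRing.Theory Num.Theory.
Import numFieldNormedType.Exports.
Local Open Scope classical_set_scope.
Local Open Scope ring_scope.

(** * Inequalities for angles up to pi/4 *)

(** The derivative 2 x / (1 + x^2) is nondecreasing on [0, 1], so by the mean value theorem the
    graph of ln (1 + x^2) lies above its tangent at [a]. *)
Lemma ln1Dsqr_tangent (R : realType) (a b : R) :
  0 <= a <= 1 -> 0 <= b <= 1 ->
  ln (1 + a ^+ 2) - ln (1 + b ^+ 2) <= 2 * a * (a - b) / (1 + a ^+ 2).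
Proof.
move=> /andP[a0 a1] /andP[b0 b1].
have p1 (x : R) : 0 < 1 + x ^+ 2 by rewrite ltr_pwDl// sqr_ge0.
pose h (x : R) := ln (1 + x ^+ 2); pose dh (x : R) := 2 * x / (1 + x ^+ 2).
have dhE (x : R) : is_derive x 1 h (dh x).
  have lnx := is_derive1_ln (p1 x).
  have sx : is_derive x (1 : R) (fun x : R => 1 + x ^+ 2) (2 * x).
    by apply: is_derive_eq; rewrite /GRing.scale/=; ring.
  have := @is_derive1_comp _ (@ln R) (fun x : R => 1 + x ^+ 2) _ _ _ lnx sx.
  by rewrite mulrC.
have dh_mono (x y : R) : 0 <= x -> x <= y -> y <= 1 -> dh x <= dh y.
  move=> x0 xy y1; rewrite /dh ler_pdivrMr// mulrAC ler_pdivlMr//.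
  rewrite -subr_ge0 (_ : _ - _ = 2 * (y - x) * (1 - x * y)); last by ring.
  by apply: mulr_ge0; [rewrite mulr_ge0// subr_ge0|nra].
have hc (x y : R) : {within `[x, y], continuous h}.
  apply: continuous_subspaceT => z; apply: differentiable_continuous.
  exact/derivable1_diffP/ex_derive.
have [ab|ba] := leP a b.
  have [x + e] := MVT_segment ab (fun x _ => dhE x) (hc a b).
  rewrite in_itv/= => /andP[ax xb].
  have := dh_mono _ _ a0 ax (le_trans xb b1); rewrite -/(h a) -/(h b).
  by rewrite mulrAC -/(dh a); move: (subr_ge0 a b) e; rewrite ab; nra.
have [x + e] := MVT_segment (ltW ba) (fun x _ => dhE x) (hc b a).
rewrite in_itv/= => /andP[bx xa].
have := dh_mono _ _ (le_trans b0 bx) xa a1; rewrite -/(h a) -/(h b).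
by rewrite mulrAC -/(dh a) => xa'; rewrite e ler_wpM2r// subr_ge0 ltW.
Qed.

(** The convex function l |-> x^l lies above its tangent at l = 1; through the exponential this is 1
    + y <= e^y. *)
Lemma powR_tangent (R : realType) (x l : R) :
  0 < x -> x + (l - 1) * (x * ln x) <= x `^ l.
Proof.
move=> x0; have -> : x `^ l = expR ((l - 1) * ln x) * x.
  by rewrite -[X in _ = _ * X](lnK x0) -expRD /powR gt_eqF//; congr expR; ring.
apply: le_trans (ler_wpM2r (ltW x0) (expR_ge1Dx _)).
by rewrite le_eqVlt; apply/orP; left; apply/eqP; ring.
Qed.

(* [s], [d] and [c], [e] are the cosine and sine of two angles in [0, pi/4]. *)
Lemma angle_ineq_acute (R : realType) (l s d c e : R) :
  0 <= l <= 1 -> 0 < s -> 0 <= d <= s -> s ^+ 2 + d ^+ 2 = 1 ->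
  0 < c -> 0 <= e <= c -> c ^+ 2 + e ^+ 2 = 1 ->
  l * (c / s) + (1 - l) * (s * c + d * e) <= (c / s) `^ l.
Proof.
move=> /andP[l0 l1] s0 /andP[d0 ds] sd c0 /andP[e0 ec] ce.
have cs0 : 0 < c / s by rewrite divr_gt0.
(* Both sides agree at l = 1 and the left one is affine in l, so it suffices to compare slopes
   there: (c/s) ln (c/s) <= c/s - (s c + d e). *)
apply: le_trans (powR_tangent _ cs0).
have E (x y : R) : 0 < x -> x ^+ 2 + y ^+ 2 = 1 ->
    1 + (y / x) ^+ 2 = (x ^+ 2)^-1.
  move=> x0 xy; have x20 : x ^+ 2 != 0 by rewrite gt_eqF// exprn_gt0.
  apply: (mulIf x20); rewrite mulVf// -[RHS]xy.
  by field; rewrite gt_eqF.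
(* At the tangents d/s and e/c, 1 + tan^2 = 1/cos^2, so the logarithms differ by 2 ln (c/s). *)
have := @ln1Dsqr_tangent R (d / s) (e / c).
rewrite !E// !divr_ge0 ?(ltW c0) ?(ltW s0)// !ler_pdivrMr// !mul1r ds ec.
move=> /(_ isT isT); rewrite !lnV ?posrE ?exprn_gt0// !lnXn//.
rewrite lnM ?posrE ?invr_gt0// lnV ?posrE// => H.
have K : (c / s) * (ln c - ln s) <=
    c / s * (s ^+ 2 * (d / s * (d / s - e / c))).
  rewrite ler_pM2l//; move: H; rewrite invrK; set z := d / s - _.
  by rewrite !mulr2n; lra.
have K2 : c / s * (s ^+ 2 * (d / s * (d / s - e / c))) =
    c / s - (s * c + d * e).
  rewrite [X in c / s * X](_ : _ = (1 - s ^+ 2) - d * e * s / c).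
    by field; rewrite !gt_eqF.
  by rewrite -sd; field; rewrite !gt_eqF.
by nra.
Qed.

(** The second angle now ranges over [0, pi], and [h] is the cosine of pi/4. As a function of that
    angle the left side is A cos + B sin with 0 <= B <= A, which decreases from pi/4 to pi; hence
    beyond pi/4 its value at pi/4 is a bound. *)
Lemma angle_ineq (R : realType) (l s d c e h : R) :
  0 <= l <= 1 -> 0 < s -> 0 <= d <= s -> s ^+ 2 + d ^+ 2 = 1 ->
  0 <= e -> c ^+ 2 + e ^+ 2 = 1 -> 0 < h -> 2 * h ^+ 2 = 1 ->
  l * (c / s) + (1 - l) * (s * c + d * e) <= (Num.max c h / s) `^ l.
Proof.
move=> l01 s0 d0s sd e0 ce h0 hh; have [hc|ch] := leP h c.
  apply: angle_ineq_acute => //; first exact: lt_le_trans hc.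
  by rewrite e0/=; nra.
have hh1 : h ^+ 2 + h ^+ 2 = 1 by rewrite -hh; ring.
apply: le_trans (angle_ineq_acute l01 s0 d0s sd h0 _ hh1).
  move: l01 d0s => /andP[l0 l1] /andP[d0 ds].
  rewrite -subr_ge0; set A := l / s + (1 - l) * s; set B := (1 - l) * d.
  (* Rewritten in c + e, which is at most 2 h, and e - c, which is nonnegative beyond pi/4. *)
  rewrite (_ : _ - _ = (A + B) * (h - (c + e) / 2) + (A - B) * ((e - c) / 2)).
    have B0 : 0 <= B by rewrite mulr_ge0// subr_ge0.
    have AB : B <= A.
      rewrite -[B]add0r lerD// ?divr_ge0// ?(ltW s0)// ler_wpM2l// subr_ge0//.
    apply: addr_ge0; apply: mulr_ge0.
    - by rewrite addr_ge0// (le_trans B0).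
    - suff : c + e <= 2 * h by lra.
      apply: contraPP hh => /negP; rewrite -ltNge => H.
      by apply/eqP; rewrite lt_eqF//; nra.
    - by rewrite subr_ge0.
    - suff : c <= e by lra.
      by nra.
  by rewrite /A /B; field; rewrite gt_eqF.
by rewrite (ltW h0) lexx.
Qed.

(** * Euclidean inner product and norm *)

Definition dot {R : realType} {n : nat} (x y : 'rV[R]_n) : R :=
  \sum_(i < n) x ord0 i * y ord0 i.

Section dot.
Context {R : realType} {n : nat}.
Implicit Types (x y z u v : 'rV[R]_n) (a b t : R).

Lemma dotC x y : dot x y = dot y x.
Proof. by apply: eq_bigr => i _; rewrite mulrC. Qed.

Lemma dotDl x y z : dot (x + y) z = dot x z + dot y z.
Proof. by rewrite -big_split; apply: eq_bigr => i _; rewrite mxE mulrDl. Qed.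

Lemma dotZl a x y : dot (a *: x) y = a * dot x y.
Proof. by rewrite mulr_sumr; apply: eq_bigr => i _; rewrite mxE mulrA. Qed.

Lemma dotDr x y z : dot x (y + z) = dot x y + dot x z.
Proof. by rewrite dotC dotDl !(dotC _ x). Qed.

Lemma dotZr a x y : dot x (a *: y) = a * dot x y.
Proof. by rewrite dotC dotZl dotC. Qed.

Lemma dotNl x y : dot (- x) y = - dot x y.
Proof. by rewrite -scaleN1r dotZl mulN1r. Qed.

Lemma dotNr x y : dot x (- y) = - dot x y.
Proof. by rewrite dotC dotNl dotC. Qed.

Lemma dot0l x : dot 0 x = 0.
Proof. by rewrite -(scale0r 0) dotZl mul0r. Qed.

Lemma dot0r x : dot x 0 = 0.
Proof. by rewrite dotC dot0l. Qed.

Lemma dotxx x : dot x x = enorm x ^+ 2.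
Proof.
rewrite sqr_sqrtr; first by apply: eq_bigr => i _; rewrite expr2.
by apply: sumr_ge0 => i _; rewrite sqr_ge0.
Qed.

Lemma enorm_ge0 x : 0 <= enorm x. Proof. exact: sqrtr_ge0. Qed.

Lemma coord_le_enorm x i : `|x ord0 i| <= enorm x.
Proof.
rewrite -ler_sqr ?nnegrE ?enorm_ge0// -dotxx real_normK ?num_real//.
rewrite /dot (bigD1 i)//= -expr2 lerDl; apply: sumr_ge0 => j _.
by rewrite -expr2 sqr_ge0.
Qed.

Lemma enorm_eq0 x : (enorm x == 0) = (x == 0).
Proof.
apply/eqP/eqP => [x0|->]; last first.
  by apply/eqP; rewrite -sqrf_eq0 -dotxx dot0l.
apply/rowP => i; rewrite mxE; apply/normr0_eq0/le_anti.
by rewrite normr_ge0 -x0 coord_le_enorm.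
Qed.

Lemma enorm_gt0 x : (0 < enorm x) = (x != 0).
Proof. by rewrite lt_neqAle enorm_ge0 andbT eq_sym enorm_eq0. Qed.

Lemma enorm0 : enorm (0 : 'rV[R]_n) = 0.
Proof. by apply/eqP; rewrite enorm_eq0. Qed.

Lemma enormZ a x : enorm (a *: x) = `|a| * enorm x.
Proof.
apply/eqP; rewrite -(@eqrXn2 _ 2)// ?mulr_ge0 ?enorm_ge0//.
by rewrite -dotxx dotZl dotZr dotxx mulrA -expr2 exprMn real_normK ?num_real.
Qed.

Lemma enormZge0 a x : 0 <= a -> enorm (a *: x) = a * enorm x.
Proof. by move=> a0; rewrite enormZ ger0_norm. Qed.

Lemma enormN x : enorm (- x) = enorm x.
Proof. by rewrite -scaleN1r enormZ normrN1 mul1r. Qed.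

Lemma dot_le_enorm x y : dot x y <= enorm x * enorm y.
Proof.
have [->|x0] := eqVneq x 0; first by rewrite dot0l enorm0 mul0r.
have [->|y0] := eqVneq y 0; first by rewrite dot0r enorm0 mulr0.
rewrite -enorm_gt0 in x0; rewrite -enorm_gt0 in y0.
have : 0 <= dot (enorm y *: x - enorm x *: y) (enorm y *: x - enorm x *: y).
  by rewrite dotxx sqr_ge0.
rewrite !(dotDl, dotDr, dotNl, dotNr, dotZl, dotZr) (dotC y x) !dotxx => H.
have K : 0 <= 2 * (enorm x * enorm y) * (enorm x * enorm y - dot x y).
  by apply: le_trans H _; rewrite le_eqVlt; apply/orP; left; apply/eqP; ring.
by rewrite pmulr_rge0 ?subr_ge0// in K; rewrite !mulr_gt0.
Qed.

Lemma dot_continuous u : continuous (dot u : 'rV[R]_n -> R).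
Proof.
apply: continuous_big; first exact: add_continuous.
move=> i _ x; apply: (@continuousM _ _ (cst (u ord0 i))
  (fun z : 'rV[R]_n => z ord0 i)).
  exact: cst_continuous.
exact: coord_continuous.
Qed.

Lemma enorm_continuous : continuous (@enorm R n).
Proof.
have sq : continuous (fun x : 'rV[R]_n => \sum_(i < n) x ord0 i ^+ 2).
  apply: continuous_big; first exact: add_continuous.
  move=> i _ x; apply: (@continuousM _ _ (fun z : 'rV[R]_n => z ord0 i)
                         (fun z : 'rV[R]_n => z ord0 i));
    exact: coord_continuous.
by move=> x; apply: continuous_comp; [exact: sq|exact: sqrt_continuous].
Qed.

End dot.

(** * Convex bodies as intersections of half-spaces *)

Section bodies.
Context {R : realType} {n : nat}.
Implicit Types (x y z u v : 'rV[R]_n) (K L D : set 'rV[R]_n) (M a b t : R).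

(** Closed convexity, encoded as being an intersection of closed half-spaces: this form passes to
    arbitrary intersections, as needed for [flow]. *)
Definition separated D := forall y, ~ D y ->
  exists v k, (forall z, D z -> dot v z <= k) /\ k < dot v y.

(** One constant serves for both radii, since a power t of the body then simply turns [M] into
    M^t. *)
Definition sandwiched M D :=
  [/\ 1 <= M, forall x, enorm x <= M^-1 -> D x & forall x, D x -> enorm x <= M].

Lemma separated_convex D x y t : separated D -> D x -> D y ->
  0 <= t <= 1 -> D (t *: x + (1 - t) *: y).
Proof.
move=> sD Dx Dy t01; apply: contrapT => /sD[v [k [vk]]].
by rewrite dotDr !dotZr; move: (vk _ Dx) (vk _ Dy); nra.
Qed.

Lemma separated_closed D : separated D -> closed D.
Proof.
move=> sD; rewrite -[D]setCK; apply: open_closedC; rewrite openE => y.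
move=> /sD[v [k [vk ky]]]; have : \forall z \near y, k < dot v z.
  exact: (cvgr_gt _ (@dot_continuous _ _ v y)).
by apply: filterS => z kz Dz; move: (vk _ Dz); rewrite leNgt kz.
Qed.

Lemma convex_setE D x y t :
  convex_set (D : set (convex_lmodType 'rV[R]_n)) -> D x -> D y ->
  0 <= t <= 1 -> D (t *: x + (1 - t) *: y).
Proof.
move=> cD /mem_set Dx /mem_set Dy /andP[t0 t1].
by have := cD _ _ (Itv01 t0 t1) Dx Dy; rewrite inE.
Qed.

(* The separating hyperplane is orthogonal to [y - z0], where [z0] is the point
   of [D] closest to [y]. *)
Lemma compact_convex_separated D : D !=set0 -> compact D ->
  convex_set (D : set (convex_lmodType 'rV[R]_n)) -> separated D.
Proof.
move=> D0 cptD cD y Dy.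
have dc : {within D, continuous (fun z => enorm (z - y))}.
  apply: continuous_subspaceT => z; apply: continuous_comp.
    by apply: continuousB; [exact: cvg_id|exact: cst_continuous].
  exact: enorm_continuous.
have [z0 /set_mem Dz0 zmin] := compact_EVT_min D0 cptD dc.
exists (y - z0), (dot (y - z0) z0); split; last first.
  rewrite -subr_gt0 -dotNr -dotDr dotxx exprn_gt0// enorm_gt0 subr_eq0.
  by apply/eqP => yz; apply: Dy; rewrite yz.
move=> z Dz; rewrite leNgt; apply/negP; rewrite -subr_gt0 -dotNr -dotDr.
set w := z - z0; set q := dot _ w => q0.
(* This [t] lies in ]0, 1] and satisfies t |w|^2 < q, so that z0 + t w is strictly closer to [y]
   than [z0]. *)
pose t := q / (q + enorm w ^+ 2).
have w0 : 0 <= enorm w ^+ 2 by rewrite sqr_ge0.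
have qw0 : 0 < q + enorm w ^+ 2 by rewrite ltr_pwDl.
have t01 : 0 <= t <= 1.
  by rewrite divr_ge0 ?(ltW q0) ?(ltW qw0)//= ler_pdivrMr// mul1r lerDl.
have := zmin _ (mem_set (convex_setE cD Dz Dz0 t01)).
rewrite -ler_sqr ?nnegrE ?enorm_ge0// -!dotxx.
rewrite (_ : _ + _ - y = - (y - z0) + t *: w); last first.
  rewrite /w scalerBr scalerBl scale1r opprB !addrA.
  by apply/rowP => i; rewrite !mxE; ring.
rewrite (_ : z0 - y = - (y - z0)) ?opprB// -opprB.
rewrite !(dotDl, dotDr _ (- _)) !(dotNl, dotNr, dotZl, dotZr) (dotC w) -/q !dotxx.
have tE : t * (q + enorm w ^+ 2) = q by rewrite divfK// gt_eqF.
have t0 : 0 < t by rewrite divr_gt0.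
by nra.
Qed.

Lemma convex_bodiesP K :
  convex_bodies K <-> separated K /\ exists M, sandwiched M K.
Proof.
split=> [[cptK cK iK]|[sK [M [M1 inK Kle]]]].
  have K0 : K !=set0 by exists 0; exact: interior_subset.
  split; first exact: compact_convex_separated.
  have [r /set_mem _ rmax] := compact_EVT_max K0 cptK
    (continuous_subspaceT enorm_continuous).
  move/nbhs_ballP : iK => [e /= e0 eK].
  (* [r] is a point of [K] of largest Euclidean norm, and [e] the radius of a sup norm ball in [K].
     The term 2 / e makes M^-1 <= e / 2, and the sup norm is at most the Euclidean one. *)
  have M1 : 1 <= 1 + enorm r + 2 / e.
    by rewrite -addrA lerDl addr_ge0 ?enorm_ge0// divr_ge0// ltW.
  exists (1 + enorm r + 2 / e); split => // x.
    move=> xM; apply: eK; rewrite -ball_normE/= sub0r normrN.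
    apply: (@le_lt_trans _ _ (e / 2)); last by lra.
    have : enorm x <= e / 2.
      apply: le_trans xM _; rewrite -[leRHS]invrK invf_div lef_pV2 ?posrE ?divr_gt0//.
        by rewrite lerDr addr_ge0// enorm_ge0.
      exact: lt_le_trans ltr01 M1.
    move=> xe; rewrite /Num.norm/= mx_normrE.
    apply/bigmax_leP; split => [|[i j] _ /=]; first by rewrite divr_ge0// ltW.
    by rewrite (ord1 i) (le_trans (coord_le_enorm x j)).
  move=> /mem_set/rmax/le_trans; apply.
  by rewrite -addrA addrCA lerDl addr_ge0// divr_ge0// ltW.
split.
- apply: bounded_closed_compact (separated_closed sK).
  exists M; split; first exact: num_real.
  move=> N MN x /Kle xM; rewrite /Num.norm/= mx_normrE.
  have MN' := le_trans xM (ltW MN).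
  apply/bigmax_leP; split => [|[i j] _ /=]; first exact: le_trans (enorm_ge0 x) _.
  by rewrite (ord1 i) (le_trans (coord_le_enorm x j)).
- move=> x y t /set_mem Kx /set_mem Ky; apply/mem_set.
  by apply: (separated_convex sK Kx Ky); rewrite ge0 le1.
- have M0 : enorm (0 : 'rV[R]_n) < M^-1.
    by rewrite enorm0 invr_gt0 (lt_le_trans _ M1).
  have : \forall x \near (0 : 'rV[R]_n), enorm x < M^-1.
    exact: (cvgr_lt _ (@enorm_continuous _ _ 0)).
  by apply: filterS => x /ltW/inK.
Qed.

End bodies.

(** * Radial power maps *)

Section radial_power.
Context {R : realType} {n : nat}.
Implicit Types (x y z u v : 'rV[R]_n) (K : set 'rV[R]_n) (a c l m : R).

(** The map P_l. Being a multiple of [x], the image of 0 is 0 for every [l], also when the exponent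
    l - 1 is negative. *)
Definition rpow l x := enorm x `^ (l - 1) *: x.

Lemma enorm_rpow l x : 0 < l -> enorm (rpow l x) = enorm x `^ l.
Proof.
move=> l0; rewrite /rpow enormZge0 ?powR_ge0// mulrC mulr_powRB1//.
exact: enorm_ge0.
Qed.

Lemma rpow1 x : rpow 1 x = x.
Proof. by rewrite /rpow subrr powRr0 scale1r. Qed.

Lemma rpow0r l : rpow l 0 = 0.
Proof. by rewrite /rpow scaler0. Qed.

Lemma rpowM l m x : 0 < l -> rpow m (rpow l x) = rpow (l * m) x.
Proof.
move=> l0; have [->|x0] := eqVneq x 0; first by rewrite !rpow0r.
rewrite {1}/rpow enorm_rpow// /rpow scalerA -powRrM -powRD.
  by congr (_ `^ _ *: _); ring.
by rewrite enorm_eq0 x0 implybT.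
Qed.

Lemma rpowVK l : 0 < l -> cancel (rpow l^-1) (rpow l).
Proof. by move=> l0 x; rewrite rpowM ?invr_gt0// mulVf ?gt_eqF// rpow1. Qed.

Lemma rpowZ l c x : 0 < c -> 0 < l -> rpow l (c *: x) = c `^ l *: rpow l x.
Proof.
move=> c0 l0; rewrite /rpow enormZge0 ?(ltW c0)// powRM ?enorm_ge0 ?(ltW c0)//.
by rewrite !scalerA mulrAC (mulrC _ c) mulr_powRB1 ?(ltW c0).
Qed.


End radial_power.

(** * Convexity of radial powers of nearly round bodies *)

Section radial_power_convex.
Context {R : realType} {n : nat}.
Implicit Types (x y z u v : 'rV[R]_n) (K : set 'rV[R]_n) (a c l m : R).

(** Triangle inequality for angles: the cosine of the angle from [x] to [z] is at most that of the
    difference of their angles to [u]. Cauchy-Schwarz is applied to the components orthogonal to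
    [u], whose norms are the two sines. *)
Lemma dot_le_cosB u x z : enorm u = 1 -> enorm x = 1 -> enorm z = 1 ->
  dot x z <= dot u x * dot u z +
    Num.sqrt (1 - dot u x ^+ 2) * Num.sqrt (1 - dot u z ^+ 2).
Proof.
move=> u1 x1 z1.
have orthE y : enorm y = 1 ->
    Num.sqrt (1 - dot u y ^+ 2) = enorm (y - dot u y *: u).
  move=> y1; rewrite -[RHS]ger0_norm ?enorm_ge0// -sqrtr_sqr -dotxx.
  rewrite dotDl !dotDr !(dotNl, dotNr, dotZl, dotZr) !dotxx (dotC y u) y1 u1.
  by congr Num.sqrt; ring.
rewrite !orthE// -lerBlDl; apply: le_trans (dot_le_enorm _ _).
rewrite dotDl !dotDr !(dotNl, dotNr, dotZl, dotZr) !dotxx (dotC x u) u1.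
by rewrite le_eqVlt; apply/orP; left; apply/eqP; ring.
Qed.

Lemma enorm_normalize x : x != 0 -> enorm ((enorm x)^-1 *: x) = 1.
Proof.
rewrite -enorm_gt0 => x0.
by rewrite enormZge0 ?invr_ge0 ?enorm_ge0// mulVf// gt_eqF.
Qed.

(* [v] is the gradient at [rpow l x], up to a positive factor, of the function
   whose level sets are the images under [rpow l] of the hyperplanes orthogonal
   to [u]. *)
Lemma rpow_gradient_le l u x z (h := (Num.sqrt 2)^-1 : R)
    (v := (l / dot u x) *: u + ((1 - l) / enorm x ^+ 2) *: x) :
  0 < l <= 1 -> 0 < dot u x -> h * (enorm u * enorm x) <= dot u x -> z != 0 ->
  dot v (rpow l z) <= enorm x `^ (l - 1) *
    (Num.max (dot u z) (h * (enorm u * enorm z)) / dot u x) `^ l.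
Proof.
move=> l01 ux0 ux z0.
have h0 : 0 < h by rewrite invr_gt0 sqrtr_gt0.
have hh : 2 * h ^+ 2 = 1 by rewrite exprVn sqr_sqrtr// divff.
have u0 : u != 0 by apply: contraTneq ux0 => ->; rewrite dot0l ltxx.
have x0 : x != 0 by apply: contraTneq ux0 => ->; rewrite dot0r ltxx.
have [U0 X0 Z0] : [/\ 0 < enorm u, 0 < enorm x & 0 < enorm z].
  by rewrite !enorm_gt0.
have [u1 x1 z1] := And3 (enorm_normalize u0) (enorm_normalize x0)
  (enorm_normalize z0).
have := dot_le_cosB u1 x1 z1.
rewrite !(dotZl, dotZr).
(* [s], [d] are the cosine and sine of the angle from [u] to [x], and [c], [e] those of the angle
   from [u] to [z]. The first angle is at most pi/4 because h <= s. *)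
set s := _ * (_ * dot u x); set c := _ * (_ * dot u z).
set d := Num.sqrt _; set e := Num.sqrt _.
have uxE : dot u x = s * (enorm u * enorm x).
  by rewrite /s; field; rewrite !gt_eqF.
have uzE : dot u z = c * (enorm u * enorm z).
  by rewrite /c; field; rewrite !gt_eqF.
have hs : h <= s by move: ux; rewrite uxE ler_pM2r// mulr_gt0.
have s1 : 0 <= 1 - s ^+ 2.
  have : s <= 1.
    have := dot_le_enorm u x; rewrite uxE -{2}[_ * enorm x]mul1r ler_pM2r//.
    by rewrite mulr_gt0.
  by have := lt_le_trans h0 hs; nra.
have c1 : 0 <= 1 - c ^+ 2.
  have : c <= 1.
    have := dot_le_enorm u z; rewrite uzE -{2}[_ * enorm z]mul1r ler_pM2r//.
    by rewrite mulr_gt0.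
  have : - 1 <= c.
    have := dot_le_enorm (- u) z; rewrite dotNl uzE enormN.
    by rewrite -mulNr -{2}[_ * enorm z]mul1r ler_pM2r ?mulr_gt0//; lra.
  by nra.
have s0 : 0 < s := lt_le_trans h0 hs.
have d0s : 0 <= d <= s.
  rewrite sqrtr_ge0/= -ler_sqr ?nnegrE ?sqrtr_ge0// ?(ltW s0)//.
  by rewrite sqr_sqrtr//; nra.
have sd : s ^+ 2 + d ^+ 2 = 1 by rewrite sqr_sqrtr// subrKC.
have ce : c ^+ 2 + e ^+ 2 = 1 by rewrite sqr_sqrtr// subrKC.
have e0 : 0 <= e by exact: sqrtr_ge0.
move: l01 => /andP[l0 l1]; have l01 : 0 <= l <= 1 by rewrite (ltW l0).
have := angle_ineq l01 s0 d0s sd e0 ce h0 hh.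
set m := Num.max c h => ineq xz.
have m0 : 0 < m by rewrite lt_max h0 orbT.
(* The norms are now factored out of both sides, which leaves [angle_ineq]. *)
have -> : Num.max (dot u z) (h * (enorm u * enorm z)) / dot u x =
    (enorm z / enorm x) * (m / s).
  rewrite uzE uxE -maxr_pMl ?mulr_ge0 ?enorm_ge0// -/m.
  by field; rewrite !gt_eqF.
rewrite powRM ?divr_ge0 ?(ltW Z0) ?(ltW X0) ?(ltW m0) ?(ltW s0)//.
rewrite powRM ?invr_ge0 ?(ltW Z0) ?(ltW X0)//.
have -> : (enorm x)^-1 `^ l = (enorm x `^ l)^-1.
  by rewrite -powR_inv1 ?(ltW X0)// -powRrM mulN1r powRN.
rewrite (@powRB _ (enorm x)) ?(gt_eqF X0) ?implybT// powRr1 ?(ltW X0)//.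
have zl : enorm z `^ l = enorm z * enorm z `^ (l - 1).
  by rewrite mulr_powRB1// ltW.
rewrite zl /v dotDl !dotZl.
have P0 : 0 < enorm z `^ (l - 1) by exact: powR_gt0.
have Q0 : 0 < enorm x `^ l by exact: powR_gt0.
rewrite [leRHS](_ : _ = enorm z `^ (l - 1) *
    (enorm z / enorm x * (m / s) `^ l)); last by field; rewrite !gt_eqF.
rewrite ler_pM2l//.
have -> : l / dot u x * dot u z = enorm z / enorm x * (l * (c / s)).
  by rewrite uxE uzE; field; rewrite !gt_eqF.
have -> : (1 - l) / enorm x ^+ 2 * dot x z = enorm z / enorm x *
   ((1 - l) * ((enorm x)^-1 * ((enorm z)^-1 * dot x z))).
  by field; rewrite !gt_eqF.
rewrite -mulrDr ler_pM2l ?divr_gt0//; apply: le_trans ineq.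
by rewrite lerD2l ler_wpM2l// subr_ge0.
Qed.

(** Let a half-space dot u <= k separate [x] from [K]. The inner ball gives a |u| <= k, hence |u|
    |z| / sqrt 2 <= k whenever |z| <= sqrt 2 a. For z = x this puts [x] within pi/4 of [u]; for [z]
    in [K] it bounds the maximum in [rpow_gradient_le] by [k]. The gradient at [rpow l x] therefore
    separates it from the image. *)
Lemma rpow_separated K a l : separated K -> 0 < a -> 0 < l <= 1 ->
  (forall x, enorm x <= a -> K x) ->
  (forall x, K x -> enorm x <= Num.sqrt 2 * a) ->
  separated (rpow l @` K).
Proof.
move=> sK a0 l01 inK Kle y Ky; have /andP[l0 l1] := l01.
have q0 : (0 : R) < Num.sqrt 2 by rewrite sqrtr_gt0.
have Kpow z : K z -> enorm z `^ l <= (Num.sqrt 2 * a) `^ l.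
  move=> Kz; apply: ge0_ler_powR (Kle _ Kz); first exact: ltW.
    exact: enorm_ge0.
  by rewrite nnegrE mulr_ge0 ?ltW.
pose x := rpow l^-1 y.
have yE : y = rpow l x by rewrite /x rpowVK.
clearbody x; have Kx : ~ K x by move=> Kx; apply: Ky; exists x.
(* Beyond the outer ball, [y] itself is a separating direction: the image lies in the ball of radius
   (sqrt 2 a)^l. *)
have [|xa] := ltP (Num.sqrt 2 * a) (enorm x).
  move=> ax; exists y, (enorm y * (Num.sqrt 2 * a) `^ l); split.
    move=> _ [z Kz <-]; apply: le_trans (dot_le_enorm _ _) _.
    by rewrite ler_wpM2l ?enorm_ge0// enorm_rpow// Kpow.
  have ay : (Num.sqrt 2 * a) `^ l < enorm y.
    rewrite yE enorm_rpow//; apply: gt0_ltr_powR; rewrite ?nnegrE ?enorm_ge0//.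
    by rewrite mulr_ge0 ?ltW.
  by rewrite dotxx expr2 ltr_pM2l// (le_lt_trans _ ay)// powR_ge0.
have [u [k [uk ku]]] := sK _ Kx.
have k0 : 0 <= k by rewrite -(dot0r u); apply/uk/inK; rewrite enorm0 ltW.
have ux0 : 0 < dot u x by exact: le_lt_trans ku.
have u0 : u != 0 by apply: contraTneq ux0 => ->; rewrite dot0l ltxx.
have U0 : 0 < enorm u by rewrite enorm_gt0.
have ak : a * enorm u <= k.
  have := uk ((a / enorm u) *: u); rewrite dotZr dotxx => H.
  rewrite (_ : a * _ = a / enorm u * enorm u ^+ 2); last by field; rewrite gt_eqF.
  apply: H; apply: inK; rewrite enormZge0 ?divr_ge0 ?(ltW a0) ?(ltW U0)//.
  by rewrite divfK ?lexx ?gt_eqF.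
have hz z : enorm z <= Num.sqrt 2 * a ->
    (Num.sqrt 2)^-1 * (enorm u * enorm z) <= k.
  move=> za; apply: le_trans ak; rewrite mulrCA mulrC ler_pM2r//.
  by rewrite mulrC ler_pdivrMr// mulrC.
have x0 : x != 0 by apply: contraTneq ux0 => ->; rewrite dot0r ltxx.
have X0 : 0 < enorm x by rewrite enorm_gt0.
exists ((l / dot u x) *: u + ((1 - l) / enorm x ^+ 2) *: x).
exists (enorm x `^ (l - 1) * (k / dot u x) `^ l); split; last first.
  have ->: dot ((l / dot u x) *: u + ((1 - l) / enorm x ^+ 2) *: x) y =
      enorm x `^ (l - 1).
    rewrite yE /rpow dotZr dotDl !dotZl dotxx !divfK ?gt_eqF ?exprn_gt0//.
    by rewrite subrKC mulr1.
  rewrite gtr_pMr ?powR_gt0//.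
  suff : (k / dot u x) `^ l < 1 `^ l by rewrite powR1.
  have ku0 : 0 <= k / dot u x by rewrite divr_ge0// ltW.
  by apply: gt0_ltr_powR; rewrite ?nnegrE// ltr_pdivrMr// mul1r.
move=> _ [z Kz <-]; have [->|z0] := eqVneq z 0.
  by rewrite rpow0r dot0r mulr_ge0 ?powR_ge0.
apply: le_trans (rpow_gradient_le l01 ux0 (le_trans (hz _ xa) (ltW ku)) z0) _.
rewrite ler_wpM2l ?powR_ge0//; apply: ge0_ler_powR; first exact: ltW.
- rewrite nnegrE divr_ge0 ?(ltW ux0)// le_max mulr_ge0 ?orbT ?invr_ge0 ?ltW//.
  by rewrite mulr_gt0 ?enorm_gt0.
- by rewrite nnegrE divr_ge0// ltW.
- by rewrite ler_pM2r ?invr_gt0// ge_max uk//= hz// Kle.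
Qed.

End radial_power_convex.

(** * The least flow away from exponent 1 *)

Section flow.
Context {R : realType} {n : nat}.
Implicit Types (x y z u v : 'rV[R]_n) (K L : set 'rV[R]_n) (M c s t l m : R).
Implicit Types T : R -> set 'rV[R]_n.

(** The order of time: starting at 1, the flow runs down towards 0 and up to infinity along two
    separate branches. *)
Definition before s t := (0 < t <= s) && (s <= 1) || (1 <= s <= t).

Lemma before_gt0 s t : before s t -> 0 < s /\ 0 < t.
Proof. by rewrite /before; lra. Qed.

Lemma before1 t : 0 < t -> before 1 t.
Proof. by rewrite /before; lra. Qed.

Lemma before_trans s t l : before s t -> before t l -> before s l.
Proof. by rewrite /before; lra. Qed.

(** The exponents before a given one lie on a single branch, hence are comparable. *)
Lemma before_between s t l :
  before l t -> before s t -> ~~ before l s -> before s l.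
Proof. by rewrite /before; lra. Qed.


(* [T] moves away from [T 1] at least as fast as the radial powers do; the
   powers of [K] form the least such family of intersections of half-spaces. *)
Definition barrier K T := [/\ K `<=` T 1, forall s, 0 < s -> separated (T s) &
  forall s t, before s t -> forall x, T s x -> T t (rpow (t / s) x)].

Definition flow t K := [set x | forall T, barrier K T -> T t x].

Lemma separatedT : separated ([set: 'rV[R]_n]).
Proof. by move=> y; case. Qed.

Lemma flow_separated t K : 0 < t -> separated (flow t K).
Proof.
move=> t0 y /existsNP[T /not_implyP[bT Ty]].
have [_ /(_ _ t0 _ Ty)[v [k [vk ky]]] _] := bT.
by exists v, k; split=> // z /(_ _ bT)/vk.
Qed.

Lemma flow_barrier K : barrier K (flow^~ K).
Proof.
split=> [x Kx T [KT _ _]|s|s t st x Tx T bT]; first exact: KT.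
  exact: flow_separated.
by have [_ _ /(_ _ _ st)] := bT; apply; exact: Tx.
Qed.

Lemma flow_step K s t x : before s t -> flow s K x -> flow t K (rpow (t / s) x).
Proof. by move=> st; have [_ _] := flow_barrier K; apply. Qed.

Lemma flow_sub1 K : K `<=` flow 1 K.
Proof. by case: (flow_barrier K). Qed.

Lemma flow_rpow K t x : 0 < t -> K x -> flow t K (rpow t x).
Proof.
by move=> t0 /flow_sub1/(flow_step (before1 t0)); rewrite divr1.
Qed.

Lemma flowS t K L : K `<=` L -> flow t K `<=` flow t L.
Proof.
by move=> KL x Kx T [LT sT Tstep]; apply: Kx; split=> //; exact: subset_trans LT.
Qed.

(** Each inclusion tests minimality on a family built from a given barrier [T]. For the first one, s
    |-> T (l s) is [T] restarted at time [l]; for the second, [T] is appended at time [l] to the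
    flow of [K]. *)
Lemma flowM l m K : before l (l * m) -> flow m (flow l K) = flow (l * m) K.
Proof.
move=> blm; have [l0 lm0] := before_gt0 blm.
have m0 : 0 < m by rewrite pmulr_rgt0 in lm0.
apply/seteqP; split => x.
  move=> Kx T bT; have [KT sT Tstep] := bT.
  pose S s := if before l (l * s) then T (l * s) else setT.
  suff /Kx : barrier (flow l K) S by rewrite /S blm.
  split=> [z|s s0|s t st z]; rewrite /S.
  (* At time 1 the restarted family is [T l], which contains [flow l K] by minimality. *)
  - by rewrite mulr1; case: ifP => // _; apply.
  - by case: ifP => _; [apply: sT; rewrite mulr_gt0|exact: separatedT].
  - have [s0 t0] := before_gt0 st.
    case: (boolP (before l (l * t))) => [blt|//]; have : before l (l * s).
      by move: st blt; rewrite /before; nra.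
    move=> bls; rewrite bls => Tz.
    rewrite (_ : t / s = (l * t) / (l * s)); last by field; rewrite !gt_eqF.
    by apply: Tstep => //; move: st blt bls; rewrite /before; nra.
move=> Kx T bT; have [KT sT Tstep] := bT.
pose S s := if before l s then T (s / l) else flow s K.
suff /Kx : barrier K S by rewrite /S blm mulrAC divff ?gt_eqF// mul1r.
split=> [z Kz|s s0|s t st z]; rewrite /S.
- case: ifP => [bl|_]; last exact: flow_sub1.
  have l1 : l = 1 by move: bl; rewrite /before; lra.
  by rewrite l1 divr1; apply: KT; rewrite l1; exact: flow_sub1.
- case: ifP => _; last exact: flow_separated.
  by apply: sT; rewrite divr_gt0.
- have [s0 t0] := before_gt0 st.
  case: ifPn => [bls|nbls].
    rewrite (before_trans bls st) => Tz.
    rewrite (_ : t / s = (t / l) / (s / l)); last by field; rewrite !gt_eqF.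
    have [sE tE] : s = s / l * l /\ t = t / l * l by rewrite !divfK ?gt_eqF.
    have [a0 b0] : 0 < s / l /\ 0 < t / l by rewrite !divr_gt0.
    move: (s / l) (t / l) sE tE a0 b0 Tz => a b sE tE a0 b0 Tz.
    by apply: Tstep => //; move: st bls; rewrite sE tE /before; nra.
  case: ifPn => [blt|_]; last exact: flow_step.
  (* The step from [s] to [t] crosses the junction: flow from [s] to [l], enter [T 1], then follow
     [T] from 1 to t / l. *)
  move=> /(flow_step (before_between blt st nbls))/KT.
  move=> /(Tstep _ _ (before1 (divr_gt0 t0 l0))).
  rewrite divr1 rpowM ?divr_gt0// (_ : l / s * (t / l) = t / s)//.
  by field; rewrite !gt_eqF.
Qed.

Lemma separated_scale c K : separated K -> separated [set x | K (c *: x)].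
Proof.
move=> sK y /sK[v [k [vk ky]]]; exists (c *: v), k.
by split=> [z /vk|]; rewrite dotZl -dotZr.
Qed.

(** P_(r/s) turns dilation by c^s into dilation by c^r, so undoing these dilations makes a barrier
    for [K] out of one for [dilate c K]. *)
Lemma flow_scale c t K x : 0 < c -> 0 < t ->
  flow t K x -> flow t (dilate c K) (c `^ t *: x).
Proof.
move=> c0 t0 Kx T [KT sT Tstep].
apply: (Kx (fun s => [set y | T s (c `^ s *: y)])); split=> [z Kz|s s0|s r sr z /=].
- by rewrite /= powRr1 ?(ltW c0)//; apply: KT; exists z.
- exact/separated_scale/sT.
- have [s0 r0] := before_gt0 sr; move=> /(Tstep _ _ sr).
  by rewrite rpowZ ?powR_gt0 ?divr_gt0// -powRrM mulrC divfK// gt_eqF.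
Qed.

Lemma dilateK c K : c != 0 -> dilate c^-1 (dilate c K) = K.
Proof.
move=> c0; rewrite /dilate image_comp -[RHS]image_id; apply: eq_imagel => x _ /=.
by rewrite scalerA mulVf// scale1r.
Qed.

Lemma flow_dilate c t K : 0 < c -> 0 < t ->
  flow t (dilate c K) = dilate (c `^ t) (flow t K).
Proof.
move=> c0 t0; apply/seteqP; split=> [x Kx|_ [x Kx <-]]; last exact: flow_scale.
exists ((c `^ t)^-1 *: x); last by rewrite scalerA divff ?scale1r// gt_eqF ?powR_gt0.
rewrite -powR_inv1 ?powR_ge0// -powRrM mulrN1 -mulN1r powRrM powR_inv1 ?(ltW c0)//.
rewrite -[K](@dilateK c) ?gt_eqF//.
by apply: flow_scale; rewrite ?invr_gt0.
Qed.

(** When the radial images are already closed and convex, they form a barrier themselves, and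
    minimality leaves nothing more. Values t > 1 are allowed as long as t l <= 1: this is how the
    power is inverted. *)
Lemma flow_radial K l t :
  (forall s, 0 < s <= 1 -> separated (rpow s @` K)) ->
  0 < l -> 0 < t -> l <= 1 -> t * l <= 1 ->
  flow t (rpow l @` K) = rpow (t * l) @` K.
Proof.
move=> sK l0 t0 l1 tl; apply/seteqP; split=> [x|_ [x Kx <-]]; last first.
  by rewrite mulrC -rpowM//; apply: flow_rpow => //; exists x.
(* Convexity is only known up to exponent 1; past it the whole space completes the barrier. *)
pose T s := if s * l <= 1 then rpow (s * l) @` K else setT.
move=> /(_ T); rewrite /T tl; apply; split=> [y|s s0|s r sr y].
- by rewrite mul1r l1.
- by case: ifP => sl; [apply: sK; rewrite mulr_gt0|exact: separatedT].
- have [s0 r0] := before_gt0 sr; case: (boolP (r * l <= 1)) => [rl|//].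
  have -> : s * l <= 1 by move: sr; rewrite /before; nra.
  move=> [z Kz <-]; exists z => //; rewrite rpowM ?mulr_gt0//; congr rpow.
  by field; rewrite gt_eqF.
Qed.

End flow.

(** * Bounds on powers and comparison of exponents *)

Section flow_bounds.
Context {R : realType} {n : nat}.
Implicit Types (x y z u v : 'rV[R]_n) (K L : set 'rV[R]_n) (M c s t l m r : R).

Lemma separated_ball r : 0 <= r -> separated [set x : 'rV[R]_n | enorm x <= r].
Proof.
move=> r0 y /negP; rewrite -ltNge => ry; exists y, (enorm y * r); split.
  move=> z zr; apply: le_trans (dot_le_enorm _ _) _.
  by rewrite ler_wpM2l ?enorm_ge0.
by rewrite dotxx expr2 ltr_pM2l// (le_lt_trans r0).
Qed.

(** The balls of radius M^s are carried into one another by the radial powers, hence form a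
    barrier. *)
Lemma flow_le_enorm K M t x : 0 <= M -> (forall y, K y -> enorm y <= M) ->
  0 < t -> flow t K x -> enorm x <= M `^ t.
Proof.
move=> M0 KM t0 /(_ (fun s => [set y | enorm y <= M `^ s])); apply.
split=> [y /KM|s s0|s r sr y /= yM]; first by rewrite /= powRr1.
  exact/separated_ball/powR_ge0.
have [s0 r0] := before_gt0 sr; rewrite enorm_rpow ?divr_gt0//.
rewrite [r in leRHS](_ : r = s * (r / s)); last by rewrite mulrC divfK// gt_eqF.
by rewrite [leRHS]powRrM; apply: ge0_ler_powR; rewrite ?nnegrE ?enorm_ge0 ?powR_ge0// divr_ge0// ltW.
Qed.

Lemma enorm_le_flow K r t x : 0 <= r -> (forall y, enorm y <= r -> K y) ->
  0 < t -> enorm x <= r `^ t -> flow t K x.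
Proof.
move=> r0 rK t0 xr; rewrite -(rpowVK t0 x); apply: flow_rpow => //; apply: rK.
rewrite enorm_rpow ?invr_gt0// -[leRHS](powRr1 r0) -(divff (lt0r_neq0 t0)) powRrM.
by apply: ge0_ler_powR; rewrite ?nnegrE ?enorm_ge0 ?powR_ge0// invr_ge0 ltW.
Qed.

Lemma sandwiched_flow K M t :
  sandwiched M K -> 0 < t -> sandwiched (M `^ t) (flow t K).
Proof.
move=> [M1 inK KM] t0; have M0 : 0 <= M by exact: le_trans M1.
split=> [|x|x]; first by rewrite -(powRr0 M) ler_powR// ltW.
  have -> : (M `^ t)^-1 = M^-1 `^ t.
    by rewrite -powR_inv1 ?powR_ge0// -powRrM mulrN1 -mulN1r powRrM powR_inv1.
  by apply: enorm_le_flow => //; rewrite invr_ge0.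
exact: flow_le_enorm.
Qed.

Lemma separated_star K c x :
  separated K -> K 0 -> K x -> 0 <= c <= 1 -> K (c *: x).
Proof.
move=> sK K0 Kx c01; rewrite -[_ *: x]addr0 -(scaler0 _ (1 - c)).
exact: separated_convex.
Qed.

Lemma sandwiched0 M K : sandwiched M K -> K 0.
Proof. by case=> M1 + _; apply; rewrite enorm0 invr_ge0 (le_trans _ M1). Qed.

(** The dilates of [K] by M^|s - 1| form a barrier. *)
Lemma flow_subset_dilate K M t x : separated K -> sandwiched M K -> 0 < t ->
  flow t K x -> K (M `^ (- `|t - 1|) *: x).
Proof.
move=> sK sM t0; have [M1 inK KM] := sM; have K0 := sandwiched0 sM.
have M0 : 0 < M by exact: lt_le_trans M1.
have MD a b : M `^ (a + b) = M `^ a * M `^ b by rewrite powRD// (gt_eqF M0) implybT.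
move=> /(_ (fun s => [set y | K (M `^ (- `|s - 1|) *: y)])); apply.
split=> [y|s s0|s r sr y /=].
- by rewrite /= subrr normr0 oppr0 powRr0 scale1r.
- exact: separated_scale.
have [s0 r0] := before_gt0 sr; set z := _ *: y => Kz.
have yE : y = M `^ `|s - 1| *: z.
  by rewrite /z scalerA -MD subrr powRr0 scale1r.
(* [rpow (r / s) y] is a multiple of [z], and [K] is star-shaped about 0: it is enough that the
   total factor be at most 1. *)
clearbody z; have key : enorm y `^ (r / s - 1) <= M `^ (`|r - 1| - `|s - 1|) ->
    K (M `^ (- `|r - 1|) *: rpow (r / s) y).
  move=> H; rewrite /rpow {2}yE !scalerA; apply: separated_star => //.
  rewrite !mulr_ge0 ?powR_ge0//=.
  rewrite [leRHS](_ : 1 = M `^ (- `|r - 1|) * M `^ (`|r - 1| - `|s - 1|) *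
    M `^ `|s - 1|); last by rewrite -!MD addKr addNr powRr0.
  by rewrite ler_wpM2r ?powR_ge0// ler_wpM2l ?powR_ge0.
move: sr; rewrite /before => /orP[/andP[/andP[_ rs] s1]|/andP[s1 sr]]; last first.
  (* Above 1, the outer ball gives |y| <= M^(s - 1) M = M^s, whence |y|^(r/s - 1) <= M^(r - s). *)
  apply: key; have ys : enorm y <= M `^ s.
    rewrite yE enormZge0 ?powR_ge0// ger0_norm ?subr_ge0//.
    rewrite -[s in leRHS](subrK 1) [leRHS]MD ler_wpM2l ?powR_ge0// powRr1 ?(ltW M0)//.
    exact: KM.
  rewrite !ger0_norm ?subr_ge0//; last exact: le_trans sr.
  rewrite [X in M `^ X](_ : _ = s * (r / s - 1)); last by field; rewrite gt_eqF.
  rewrite [leRHS]powRrM; apply: ge0_ler_powR; rewrite ?nnegrE ?enorm_ge0 ?powR_ge0//.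
  by rewrite subr_ge0 ler_pdivlMr// mul1r.
have r1 := le_trans rs s1.
(* Below 1 the exponent r/s - 1 is at most 0 and [key] needs |y| bounded below; for smaller [y] the
   image falls into the inner ball of [K]. *)
have [yM|yM] := leP (enorm y) (M `^ (- s)).
  apply: inK; rewrite enormZge0 ?powR_ge0// enorm_rpow ?divr_gt0//.
  rewrite ler0_norm ?subr_le0// opprK -(powR_inv1 (ltW M0))//.
  rewrite [leRHS](_ : _ = M `^ ((r - 1) + - r)); last by congr (_ `^ _); ring.
  rewrite [leRHS]MD ler_wpM2l ?powR_ge0//.
  rewrite [X in M `^ X](_ : _ = - s * (r / s)); last by field; rewrite gt_eqF.
  rewrite [leRHS]powRrM; apply: ge0_ler_powR; rewrite ?nnegrE ?enorm_ge0 ?powR_ge0//.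
  by rewrite divr_ge0// ltW.
apply: key; rewrite !ler0_norm ?subr_le0//.
have y0 : 0 < enorm y by apply: le_lt_trans yM; exact: powR_ge0.
rewrite [X in M `^ X](_ : _ = - s * (r / s - 1)); last by field; rewrite gt_eqF.
rewrite powRrM -[r / s - 1]opprK !(powRN _ (- _)) lef_pV2 ?posrE ?powR_gt0//.
apply: ge0_ler_powR; rewrite ?nnegrE ?powR_ge0 ?(ltW y0) ?(ltW yM)//.
by rewrite opprB subr_ge0 ler_pdivrMr// mul1r.
Qed.

(** The flow contains [rpow t x], of which [x] is the multiple by |x|^(1 - t); a factor M^|t - 1|
    makes up for this multiple, except near 0 when t > 1, where the inner ball of the flow takes
    over. *)
Lemma dilate_subset_flow K M t x : separated K -> sandwiched M K -> 0 < t ->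
  K x -> flow t K (M `^ (- `|t - 1|) *: x).
Proof.
move=> sK sM t0 Kx; have [M1 inK KM] := sM.
have sF := flow_separated (K := K) t0; have sMF := sandwiched_flow sM t0.
have F0 := sandwiched0 sMF; have [_ inF _] := sMF.
have M0 : 0 < M by exact: lt_le_trans M1.
have MD a b : M `^ (a + b) = M `^ a * M `^ b by rewrite powRD// (gt_eqF M0) implybT.
have [->|x0] := eqVneq x 0; first by rewrite scaler0.
rewrite -enorm_gt0 in x0.
have key : enorm x `^ (1 - t) <= M `^ `|t - 1| ->
    flow t K (M `^ (- `|t - 1|) *: x).
  move=> H; have -> : x = enorm x `^ (1 - t) *: rpow t x.
    rewrite /rpow scalerA -powRD ?(gt_eqF x0) ?implybT//.
    by rewrite addrA subrK subrr powRr0 scale1r.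
  rewrite scalerA; apply: separated_star => //; first exact: flow_rpow.
  rewrite mulr_ge0 ?powR_ge0//= -[leRHS](powRr0 M) -(addNr `|t - 1|) [leRHS]MD.
  by rewrite ler_wpM2l ?powR_ge0.
have [t1|t1] := leP t 1.
  apply: key; rewrite ler0_norm ?subr_le0// opprB.
  apply: ge0_ler_powR; rewrite ?nnegrE ?subr_ge0 ?enorm_ge0 ?(ltW M0)//.
  exact: KM.
have t10 : 0 <= t - 1 by rewrite subr_ge0 ltW.
have [xM|xM] := leP (enorm x) M^-1.
  apply: inF; rewrite enormZge0 ?powR_ge0// -powRN ger0_norm//.
  rewrite [leRHS](_ : _ = M `^ (- (t - 1) + -1)); last by congr (_ `^ _); ring.
  by rewrite MD ler_wpM2l ?powR_ge0// powR_inv1 ?(ltW M0).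
apply: key; rewrite ger0_norm// -(opprB t 1) powRN invf_ple ?posrE ?powR_gt0//.
rewrite -powRN -[- (t - 1)]mulN1r powRrM powR_inv1 ?(ltW M0)//.
by apply: ge0_ler_powR; rewrite ?nnegrE ?invr_ge0 ?enorm_ge0 ?(ltW M0) ?(ltW xM).
Qed.

(** Barriers are unconstrained at exponent 0, so the value there is prescribed. *)
Definition body_power t K := if t == 0 then @B2 R n else flow t K.

Lemma body_powerE t K : 0 < t -> body_power t K = flow t K.
Proof. by move=> t0; rewrite /body_power gt_eqF. Qed.

Lemma body_power0 K : body_power 0 K = @B2 R n.
Proof. by rewrite /body_power eqxx. Qed.

(** By the semigroup law, [flow m K] is the power m / l of [flow l K], whose constant is M^l, and
    (M^l)^|m/l - 1| = M^|l - m|. *)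
Lemma flow_compare_chain K M l m x : sandwiched M K -> before l m ->
  (flow l K x -> flow m K (M `^ (- `|l - m|) *: x)) /\
  (flow m K x -> flow l K (M `^ (- `|l - m|) *: x)).
Proof.
move=> sM lm; have [l0 m0] := before_gt0 lm.
have mE : m = l * (m / l) by field; rewrite gt_eqF.
have fE : flow m K = flow (m / l) (flow l K) by rewrite flowM -mE.
have sF := flow_separated (K := K) l0; have sMF := sandwiched_flow sM l0.
have -> : M `^ (- `|l - m|) = (M `^ l) `^ (- `|m / l - 1|).
  rewrite -powRrM mulrN -[X in - (X * _)](gtr0_norm l0) -normrM.
  by rewrite mulrBr mulr1 -mE distrC.
rewrite fE; split=> Kx.
  by apply: dilate_subset_flow => //; rewrite divr_gt0.
by apply: flow_subset_dilate => //; rewrite divr_gt0.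
Qed.

Lemma body_power_compare K M l m x : sandwiched M K -> 0 <= l -> 0 <= m ->
  body_power l K x -> body_power m K (M `^ (- `|l - m|) *: x).
Proof.
move=> sM; have [M1 _ _] := sM; have M0 : 0 < M by exact: lt_le_trans M1.
rewrite le_eqVlt => /predU1P[<-|l0]; rewrite le_eqVlt => /predU1P[<-|m0].
- by rewrite subrr normr0 oppr0 powRr0 scale1r.
- rewrite body_power0 body_powerE//= sub0r normrN gtr0_norm// => x1.
  have [_ + _] := sandwiched_flow sM m0; apply.
  by rewrite enormZge0 ?powR_ge0// powRN ler_piMr// invr_ge0 powR_ge0.
- rewrite body_power0 body_powerE// subr0 gtr0_norm// => Kx.
  have [_ _ /(_ _ Kx)] := sandwiched_flow sM l0.
  by rewrite /B2/= enormZge0 ?powR_ge0// powRN mulrC ler_pdivrMr ?mul1r// powR_gt0.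
- rewrite !body_powerE// => Kx.
  have [lm|] := boolP (before l m); first exact: (flow_compare_chain _ sM lm).1.
  have [ml _|nml nlm] := boolP (before m l).
    by rewrite distrC; apply: (flow_compare_chain _ sM ml).2.
  (* The exponents lie on opposite sides of 1: the comparison goes through 1 and the two factors
     multiply. *)
  rewrite (_ : `|l - m| = `|1 - l| + `|1 - m|); last first.
    move: nml nlm; rewrite /before.
    by case: (ler0P (l - m)); case: (ler0P (1 - l)); case: (ler0P (1 - m)); lra.
  rewrite opprD powRD ?(gt_eqF M0) ?implybT// mulrC -scalerA.
  apply: (flow_compare_chain _ sM (before1 m0)).1.
  exact: (flow_compare_chain _ sM (before1 l0)).2.
Qed.

End flow_bounds.

(** * Hausdorff convergence in terms of dilations *)

Section hausdorff.
Context {R : realType} {n : nat}.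
Implicit Types (x y z u v : 'rV[R]_n) (K L : set 'rV[R]_n) (M c d e t : R).

Definition hausdorff_set K L := [set e : R | [/\ 0 <= e,
    (forall x, K x -> exists2 y, L y & enorm (x - y) <= e) &
    (forall y, L y -> exists2 x, K x & enorm (x - y) <= e)]].

Lemma hausdorff_set_neq0 M M' K L : sandwiched M K -> sandwiched M' L ->
  hausdorff_set K L !=set0.
Proof.
move=> sK sL; have [K0 L0] := (sandwiched0 sK, sandwiched0 sL).
have [[M1 _ KM] [M'1 _ LM']] := (sK, sL).
exists (M + M'); split.
- by rewrite addr_ge0// (le_trans ler01).
- move=> x Kx; exists 0 => //; rewrite subr0 (le_trans (KM _ Kx))// lerDl.
  exact: le_trans M'1.
- move=> y Ly; exists 0 => //; rewrite sub0r enormN (le_trans (LM' _ Ly))// lerDr.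
  exact: le_trans M1.
Qed.

Lemma hausdorff_set_lbound K L : lbound (hausdorff_set K L) 0.
Proof. by move=> e []. Qed.

Lemma hausdorff_dist_lt M M' K L d : sandwiched M K -> sandwiched M' L ->
  hausdorff_dist K L < d -> exists2 e, hausdorff_set K L e & e < d.
Proof.
by move=> sK sL; apply: inf_lt; exact: hausdorff_set_neq0 sK sL.
Qed.

Lemma hausdorff_dist_le e K L : hausdorff_set K L e -> hausdorff_dist K L <= e.
Proof.
by move=> KLe; apply: ge_inf => //; exists 0; exact: hausdorff_set_lbound.
Qed.

Lemma hausdorff_dist_ge0 M M' K L : sandwiched M K -> sandwiched M' L ->
  0 <= hausdorff_dist K L.
Proof.
move=> sK sL; apply: lb_le_inf; last exact: hausdorff_set_lbound.
exact: hausdorff_set_neq0 sK sL.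
Qed.

(** The threshold involves an inner radius of [L] only, so that it stays fixed when [K] runs through
    a sequence converging to [L]. *)
Lemma hausdorff_set_subset_dilate M K L c d : separated K -> separated L ->
  sandwiched M L -> 1 < c -> d <= (1 - c^-1) / M -> hausdorff_set K L d ->
  (forall x, K x -> L (c^-1 *: x)) /\ (forall x, L x -> K (c^-1 *: x)).
Proof.
move=> sK sL [M1 inL _] c1 dM [d0 KL LK].
have M0 : 0 < M by exact: lt_le_trans M1.
have c0 : 0 < c by exact: lt_trans c1.
have ci0 : 0 < c^-1 by rewrite invr_gt0.
have ci1 : c^-1 < 1 by rewrite invf_lt1.
pose t := 1 - c^-1; have t0 : 0 < t by rewrite subr_gt0.
have t01 : 0 <= t <= 1 by rewrite (ltW t0)/= gerBl ltW.
have tE : 1 - t = c^-1 by rewrite /t subKr.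
have {}dM : d * M <= t by rewrite -ler_pdivlMr.
split=> x.
  move=> /KL[y Ly xy].
  (* x / c is a convex combination of [y] and a multiple of x - y short enough for the inner ball of
     [L]. *)
  have -> : c^-1 *: x = t *: ((c^-1 / t) *: (x - y)) + (1 - t) *: y.
    by rewrite scalerA mulrC divfK ?gt_eqF// tE scalerBr subrK.
  apply: separated_convex => //; apply: inL.
  rewrite enormZge0 ?divr_ge0 ?(ltW ci0) ?(ltW t0)//.
  have xyt : enorm (x - y) <= t / M.
    by rewrite ler_pdivlMr// (le_trans _ dM)// ler_wpM2r// ltW.
  apply: (@le_trans _ _ (c^-1 / t * (t / M))).
    by rewrite ler_wpM2l// divr_ge0 ?(ltW ci0) ?(ltW t0).
  rewrite mulrA divfK ?gt_eqF// ler_piMl ?invr_ge0 ?(ltW M0)//.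
  exact: ltW.
move=> Lx; apply: contrapT => /sK[v [k [vk kv]]].
have v0 : v != 0.
  have [z Kz _] := LK _ Lx.
  apply: contraTneq (le_lt_trans (vk _ Kz) kv) => ->.
  by rewrite !dot0l ltxx.
rewrite -enorm_gt0 in v0.
(* [w] is x / c pushed by t / M along [v]. It stays in [L] but exceeds the half-space containing [K]
   by more than the distance [d] allows. *)
pose w := t *: ((M^-1 / enorm v) *: v) + (1 - t) *: x; have Lw : L w.
  apply: separated_convex => //; apply: inL.
  rewrite enormZge0 ?divr_ge0 ?invr_ge0 ?(ltW M0) ?(ltW v0)//.
  by rewrite divfK ?lexx// gt_eqF.
have [z Kz zw] := LK _ Lw.
have : dot v (w - z) <= enorm v * d.
  apply: le_trans (dot_le_enorm _ _) _.
  by rewrite ler_wpM2l ?(ltW v0)// -enormN opprB.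
rewrite dotDr dotNr /w dotDr !dotZr dotxx tE.
have -> : t * (M^-1 / enorm v * enorm v ^+ 2) = t / M * enorm v.
  by field; rewrite !gt_eqF.
have : d * enorm v <= t / M * enorm v by rewrite ler_pM2r// ler_pdivlMr.
move: (vk _ Kz) kv; rewrite dotZr; lra.
Qed.

Lemma hausdorff_cvg_dilate (K_ : nat -> set 'rV[R]_n) K c :
  (forall i, convex_bodies (K_ i)) -> convex_bodies K ->
  hausdorff_cvg K_ K -> 1 < c ->
  \forall i \near \oo, (forall x, K_ i x -> K (c^-1 *: x)) /\
    (forall x, K x -> K_ i (c^-1 *: x)).
Proof.
move=> bK_ /convex_bodiesP[sK [M sM]] cvgK c1; have [M1 _ _] := sM.
have M0 : 0 < M by exact: lt_le_trans M1.
have d0 : 0 < (1 - c^-1) / M.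
  by rewrite divr_gt0// subr_gt0 invf_lt1// (lt_trans ltr01).
have : \forall i \near \oo, hausdorff_dist (K_ i) K < (1 - c^-1) / M.
  exact: (cvgr_lt _ cvgK).
apply: filterS => i; have [sKi [Mi sMi]] := (convex_bodiesP _).1 (bK_ i).
move=> /(hausdorff_dist_lt sMi sM)[d hd /ltW dM].
exact: hausdorff_set_subset_dilate dM hd.
Qed.

Lemma dilate_hausdorff_cvg (K_ : nat -> set 'rV[R]_n) K :
  (forall i, convex_bodies (K_ i)) -> convex_bodies K ->
  (forall c, 1 < c -> \forall i \near \oo,
    (forall x, K_ i x -> K (c^-1 *: x)) /\ (forall x, K x -> K_ i (c^-1 *: x))) ->
  hausdorff_cvg K_ K.
Proof.
move=> bK_ /convex_bodiesP[sK [M sM]] H; have [M1 _ KM] := sM.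
have M0 : 0 < M by exact: lt_le_trans M1.
apply/cvgr0Pnorm_lt => e e0.
have eM : 0 < e / 2 / M by rewrite !divr_gt0.
(* With this ratio [c], (c - 1) M = e / 2 bounds how far the dilations move points, as [K] lies in
   the ball of radius [M]. *)
have c1 : 1 < 1 + e / 2 / M by rewrite ltrDl.
apply: filterS (H _ c1) => i []; set c := 1 + _ => KiK KKi.
have [sKi [Mi sMi]] := (convex_bodiesP _).1 (bK_ i).
have c0 : 0 < c by exact: lt_trans c1.
rewrite ger0_norm; last exact: hausdorff_dist_ge0 sMi sM.
have cM : (c - 1) * M = e / 2 by rewrite /c addrAC subrr add0r divfK// gt_eqF.
apply: (@le_lt_trans _ _ (e / 2)); last by lra.
apply: hausdorff_dist_le; split=> [|x Kx|y Ky]; first by rewrite divr_ge0 ?ltW.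
  exists (c^-1 *: x); first exact: KiK.
  have {1}-> : x = c *: (c^-1 *: x) by rewrite scalerA divff ?scale1r// gt_eqF.
  rewrite -{2}[c^-1 *: x]scale1r -scalerBl enormZge0 ?subr_ge0 ?(ltW c1)//.
  by rewrite -cM ler_wpM2l ?subr_ge0 ?(ltW c1)//; exact/KM/KiK.
exists (c^-1 *: y); first exact: KKi.
rewrite -enormN opprB -{1}[y]scale1r -scalerBl.
have ci : 0 <= 1 - c^-1 by rewrite subr_ge0 invf_le1// ltW.
rewrite enormZge0// -cM ler_pM ?enorm_ge0 ?KM//.
rewrite (_ : c - 1 = c * (1 - c^-1)) ?ler_peMl ?(ltW c1)//.
by field; rewrite gt_eqF.
Qed.

End hausdorff.

(** * Properties of the power maps *)

Section body_power.
Context {R : realType} {n : nat}.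
Implicit Types (x y z : 'rV[R]_n) (K L : set 'rV[R]_n) (M a c l m t : R).

Lemma body_power_sandwiched M l K : 0 <= l -> sandwiched M K ->
  sandwiched (M `^ l) (body_power l K).
Proof.
rewrite le_eqVlt => /predU1P[<- _|l0 sM]; last first.
  by rewrite body_powerE//; exact: sandwiched_flow.
by rewrite body_power0 powRr0; split=> // x; rewrite invr1.
Qed.

Lemma body_power_separated l K : 0 <= l -> separated (body_power l K).
Proof.
rewrite le_eqVlt => /predU1P[<-|l0]; last first.
  by rewrite body_powerE//; exact: flow_separated.
by rewrite body_power0; exact: separated_ball.
Qed.

Lemma body_power_body l K : 0 <= l -> convex_bodies K ->
  convex_bodies (body_power l K).
Proof.
move=> l0 /convex_bodiesP[_ [M sM]]; apply/convex_bodiesP.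
split; first exact: body_power_separated.
by exists (M `^ l); exact: body_power_sandwiched.
Qed.

Lemma body_powerS l K L : K `<=` L -> body_power l K `<=` body_power l L.
Proof.
move=> KL; rewrite /body_power; case: ifP => _; [exact: subset_refl|].
exact: flowS.
Qed.

Lemma body_power_dilate l c K : 0 <= l -> 0 < c ->
  body_power l (dilate c K) = dilate (c `^ l) (body_power l K).
Proof.
move=> + c0; rewrite le_eqVlt => /predU1P[<-|l0]; last first.
  by rewrite !body_powerE// flow_dilate.
rewrite !body_power0 powRr0 /dilate -[LHS]image_id.
by apply: eq_imagel => x _ /=; rewrite scale1r.
Qed.

Lemma body_power1 K : convex_bodies K -> body_power 1 K = K.
Proof.
move=> /convex_bodiesP[sK [M sM]]; rewrite body_powerE//; apply/seteqP; split.
  move=> x /(flow_subset_dilate sK sM ltr01).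
  by rewrite subrr normr0 oppr0 powRr0 scale1r.
exact: flow_sub1.
Qed.

Lemma body_power_B2 l : 0 <= l -> body_power l (@B2 R n) = @B2 R n.
Proof.
rewrite le_eqVlt => /predU1P[<-|l0]; first exact: body_power0.
rewrite body_powerE//; apply/seteqP; split=> x xB.
  by have := flow_le_enorm ler01 _ l0 xB; rewrite powR1; apply.
by apply: (@enorm_le_flow _ _ _ 1) => //; rewrite powR1.
Qed.

Lemma body_powerM l m K :
  [/\ 0 <= l, l <= 1, 0 <= m & m <= 1] \/ (1 <= l /\ 1 <= m) ->
  body_power m (body_power l K) = body_power (l * m) K.
Proof.
move=> lm; have [l0 m0] : 0 <= l /\ 0 <= m.
  by case: lm => [[]|[/(le_trans ler01) + /(le_trans ler01)]].
move: l0; rewrite le_eqVlt => /predU1P[<-|l0].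
  by rewrite mul0r !body_power0 body_power_B2.
move: m0; rewrite le_eqVlt => /predU1P[<-|m0]; first by rewrite mulr0 !body_power0.
rewrite !body_powerE ?mulr_gt0// flowM//.
(* In both ranges l m is at least as far from 1 as [l], on the same side. *)
by case: lm => [[]|[]]; rewrite /before => *; nra.
Qed.

(** The two balls make every radial image of exponent at most 1 convex, so [flow_radial] applies
    twice: from 1 to [l], and from [l] back to 1. *)
Lemma body_powerK K a l : convex_bodies K -> 0 < a ->
  dilate a (@B2 R n) `<=` K -> K `<=` dilate (Num.sqrt 2 * a) (@B2 R n) ->
  0 < l -> l <= 1 -> body_power l^-1 (body_power l K) = K.
Proof.
move=> /convex_bodiesP[sK _] a0 BK KB l0 l1.
have rK s : 0 < s <= 1 -> separated (rpow s @` K).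
  move=> s01; apply: (rpow_separated sK a0 s01) => x => [xa|/KB[y y1 <-]].
    apply: BK; exists (a^-1 *: x); last by rewrite scalerA divff ?scale1r// gt_eqF.
    by rewrite /B2/= enormZge0 ?invr_ge0 ?(ltW a0)// mulrC ler_pdivrMr// mul1r.
  have qa0 : 0 <= Num.sqrt 2 * a by rewrite mulr_ge0 ?sqrtr_ge0// ltW.
  by rewrite enormZge0// ler_piMr.
have rpow1K : rpow 1 @` K = K.
  by rewrite -[RHS]image_id; apply: eq_imagel => x _; rewrite rpow1.
rewrite !body_powerE ?invr_gt0//.
have -> : flow l K = rpow l @` K by rewrite -{1}rpow1K flow_radial ?mulr1.
by rewrite flow_radial ?invr_gt0// mulVf ?gt_eqF// ?rpow1K.
Qed.

Lemma body_power_scale c l K L x : 0 < c -> 0 <= l ->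
  (forall y, K y -> L (c^-1 *: y)) ->
  body_power l K x -> body_power l L (c `^ (- l) *: x).
Proof.
move=> c0 l0 KL Kx; have KcL : K `<=` dilate c L.
  move=> y /KL Ly; exists (c^-1 *: y) => //.
  by rewrite scalerA divff ?scale1r// gt_eqF.
have := body_powerS KcL Kx; rewrite body_power_dilate// => -[y Ly <-].
by rewrite scalerA powRN mulVf ?scale1r// gt_eqF// powR_gt0.
Qed.

Lemma separated_starle L c m x : separated L -> L 0 -> 0 <= c <= m ->
  L (m *: x) -> L (c *: x).
Proof.
move=> sL L0 /andP[c0 cm] Lx.
have [m0|m0] := leP m 0.
  have c00 : c = 0 by apply/le_anti; rewrite c0 (le_trans cm).
  by rewrite c00 scale0r.
rewrite -[c](divfK (lt0r_neq0 m0)) -scalerA; apply: separated_star => //.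
by rewrite divr_ge0 ?(ltW m0)//= ler_pdivrMr// mul1r.
Qed.

(** Changing the body from [K_ i] to [K] costs a factor c^(l_i), and changing the exponent costs
    M^|l_i - l|. The exponent is always changed on [K], whose constant [M] does not depend on i. *)
Lemma body_power_continuous (K_ : nat -> set 'rV[R]_n) K
    (l_ : nat -> R) l :
  (forall i, convex_bodies (K_ i)) -> convex_bodies K ->
  (forall i, 0 <= l_ i) -> 0 <= l ->
  hausdorff_cvg K_ K -> l_ i @[i --> \oo] --> l ->
  hausdorff_cvg (fun i => body_power (l_ i) (K_ i)) (body_power l K).
Proof.
move=> bK_ bK l_0 l0 cvgK cvgl.
apply: dilate_hausdorff_cvg => [i||C C1]; [exact: body_power_body..|].
have /convex_bodiesP[sK [M sM]] := bK; have [M1 _ _] := sM.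
have C0 : 0 < C by exact: lt_trans C1.
have M0 : 0 < M by exact: lt_le_trans M1.
have lnC : 0 < ln C by rewrite ln_gt0.
have CD b d : C `^ (b + d) = C `^ b * C `^ d by rewrite powRD// (gt_eqF C0) implybT.
(* The two costs are each kept below C^(1/2); for this both [M] and [c] are written as powers of
   [C]. *)
pose A := ln M / ln C.
have ME : M = C `^ A by rewrite /powR gt_eqF// divfK ?gt_eqF// lnK.
have A0 : 0 <= A by rewrite divr_ge0 ?ln_ge0// ltW.
have l1 : 0 < l + 1 by rewrite ltr_wpDl.
pose c := C `^ (2 * (l + 1))^-1.
have c1 : 1 < c.
  by rewrite /c /powR gt_eqF// expR_gt1 mulr_gt0// invr_gt0 mulr_gt0.
have c0 : 0 < c by exact: lt_trans c1.
have factor m s : 0 <= m -> m <= l + 1 -> A * s <= 2^-1 ->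
    0 <= C^-1 <= M `^ (- s) * c `^ (- m).
  move=> m0 ml As; rewrite invr_ge0 (ltW C0)/= ME /c -!powRrM -CD.
  rewrite -powR_inv1 ?(ltW C0)// ler_powR// ?(ltW C1)//.
  rewrite !mulrN -opprD lerN2.
  have : (2 * (l + 1))^-1 * m <= 2^-1.
    by rewrite invfM -mulrA ler_piMr// mulrC ler_pdivrMr// mul1r.
  lra.
have near_l : \forall i \near \oo, l_ i <= l + 1 /\ A * `|l_ i - l| <= 2^-1.
  (* The summand 1 covers A = 0 and also gives |l_i - l| < 1, hence l_i <= l + 1. *)
  have d0 : 0 < (2 * (A + 1))^-1 by rewrite invr_gt0 mulr_gt0// ltr_wpDl.
  have H : \forall i \near \oo, `|l - l_ i| < (2 * (A + 1))^-1.
    by move/cvgrPdist_lt : cvgl; apply.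
  apply: filterS H => i; rewrite distrC.
  move: `|l_ i - l| (ler_norm (l_ i - l)) (normr_ge0 (l_ i - l)) => s ls s0 sd.
  have sA : s * (2 * (A + 1)) < 1 by rewrite -ltr_pdivlMr ?div1r// mulr_gt0// ltr_wpDl.
  by split; nra.
apply: filterS2 (near_l) (hausdorff_cvg_dilate bK_ bK cvgK c1) => i.
move=> [li Ali] [KiK KKi]; have [sKi [Mi sMi]] := (convex_bodiesP _).1 (bK_ i).
split=> x.
  move=> /(body_power_scale c0 (l_0 i) KiK)/(body_power_compare sM (l_0 i) l0).
  rewrite scalerA => Kx; apply: separated_starle (factor _ _ (l_0 i) li Ali) Kx.
    exact: body_power_separated.
  exact: sandwiched0 (body_power_sandwiched l0 sM).
move=> /(body_power_compare sM l0 (l_0 i))/(body_power_scale c0 (l_0 i) KKi).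
rewrite distrC in Ali.
rewrite scalerA mulrC => Kx; apply: separated_starle (factor _ _ (l_0 i) li Ali) Kx.
  exact: body_power_separated.
exact: sandwiched0 (body_power_sandwiched (l_0 i) sMi).
Qed.

End body_power.

Theorem theorem3p2 (R : realType) (n : nat) :
  exists pow : R -> set 'rV[R]_n -> set 'rV[R]_n,
    (forall (lambda : R) (K : set 'rV[R]_n),
      0 <= lambda -> convex_bodies K -> convex_bodies (pow lambda K)) /\
    (forall K : set 'rV[R]_n,
      convex_bodies K -> pow 1 K = K /\ pow 0 K = @B2 R n) /\
    (forall (lambda : R) (K1 K2 : set 'rV[R]_n),
      0 <= lambda -> convex_bodies K1 -> convex_bodies K2 ->
      K1 `<=` K2 -> pow lambda K1 `<=` pow lambda K2) /\
    (forall (lambda t : R) (K : set 'rV[R]_n),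
      0 <= lambda -> 0 < t -> convex_bodies K ->
      pow lambda (dilate t K) = dilate (t `^ lambda) (pow lambda K)) /\
    (forall (K_ : nat -> set 'rV[R]_n) (K : set 'rV[R]_n)
            (lambda_ : nat -> R) (lambda : R),
      (forall i, convex_bodies (K_ i)) -> convex_bodies K ->
      (forall i, 0 <= lambda_ i) -> 0 <= lambda ->
      hausdorff_cvg K_ K -> lambda_ i @[i --> \oo] --> lambda ->
      hausdorff_cvg (fun i => pow (lambda_ i) (K_ i)) (pow lambda K)) /\
    (forall (lambda mu : R) (K : set 'rV[R]_n),
      [/\ 0 <= lambda, lambda <= 1, 0 <= mu & mu <= 1] \/
      (1 <= lambda /\ 1 <= mu) ->
      convex_bodies K ->
      pow mu (pow lambda K) = pow (lambda * mu) K) /\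
    (forall (K : set 'rV[R]_n) (a : R),
      convex_bodies K -> 0 < a ->
      dilate a (@B2 R n) `<=` K ->
      K `<=` dilate (Num.sqrt 2 * a) (@B2 R n) ->
      forall lambda : R, 0 < lambda -> lambda <= 1 ->
        pow lambda^-1 (pow lambda K) = K).
Proof.
exists body_power; split; first exact: body_power_body.
split; first by move=> K bK; rewrite body_power1// body_power0.
split; first by move=> l K1 K2 _ _ _; exact: body_powerS.
split; first by move=> l t K l0 t0 _; exact: body_power_dilate.
split; first exact: body_power_continuous.
split; first by move=> l m K lm _; exact: body_powerM.
by move=> K a bK a0 BK KB l l0 l1; exact: body_powerK a0 BK KB l0 l1.
Qed.
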